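(* Let $H\in C^1(\mathbb{R}^n)$ and $\sigma\in C(\mathbb{R}^n)$ satisfy (H0) and (H1), and let $(t,x)\in(0,T]\times\mathbb{R}^n$. Then $\ell(t,x)\subset\ell^*(t,x)$, and the solution $u(t,x)$ of the Cauchy problem $u_t+H(D_xu)=0$ in $(0,T)\times\mathbb{R}^n$, $u(0,x)=\sigma(x)$, given by the Hopf-Lax formula, can be expressed as $$u(t,x)=\min_{y\in\mathbb{R}^n}\Big\{\sigma(y)+tH^*\big(\tfrac{x-y}{t}\big)\Big\}=\min_{y\in\ell^*(t,x)}\Big\{\sigma(y)+tH^*\big(\tfrac{x-y}{t}\big)\Big\}.$$
   Context: Let $T>0$, $H:\mathbb{R}^n\to\mathbb{R}$, $\sigma:\mathbb{R}^n\to\mathbb{R}$. $H^*(z)=\max_{y\in\mathbb{R}^n}\{\langle z,y\rangle-H(y)\}$ is the Fenchel conjugate of $H$; $H_p$ denotes the gradient of $H$. (H0): $H$ is strictly convex on $\mathbb{R}^n$ and superlinear, i.e. $\lim_{\|p\|\to\infty}H(p)/\|p\|=+\infty$. (H1): $\sigma$ is continuous on $\mathbb{R}^n$ and for every $(t_0,x_0)\in[0,T)\times\mathbb{R}^n$ there exist constants $r,N>0$ such that $\min_{\|y\|\le N}\{\sigma(y)+tH^*(\frac{x-y}{t})\}<\sigma(z)+tH^*(\frac{x-z}{t})$ whenever $\|z\|>N$, $t\in(0,T)$ and $|t-t_0|+\|x-x_0\|<r$. The Hopf-Lax formula is $u(t,x)=\min_{y\in\mathbb{R}^n}\{\sigma(y)+tH^*(\frac{x-y}{t})\}$,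 and $\ell(t,x)$ is the set of $y\in\mathbb{R}^n$ at which this minimum is attained. For a function $v$ on $\mathbb{R}^n$, the superdifferential is $D^+v(y)=\{p:\limsup_{h\to0}\frac{v(y+h)-v(y)-\langle p,h\rangle}{|h|}\le0\}$ and the subdifferential is $D^-v(y)=\{p:\liminf_{h\to0}\frac{v(y+h)-v(y)-\langle p,h\rangle}{|h|}\ge0\}$. Set $D^\#\sigma(y)=D^+\sigma(y)\cup D^-\sigma(y)$ if this union is nonempty, and $D^\#\sigma(y)=\{0\}$ otherwise. A generalized characteristic emanating from $(0,y)$ is a curve $x(t)=y+tH_p(q)$ with $q\in D^\#\sigma(y)$. The set $\ell^*(t,x)$ consists of all $y\in\mathbb{R}^n$ such that a generalized characteristic starting from $(0,y)$ goes through $(t,x)$, i.e. such that $x=y+tH_p(q)$ for some $q\in D^\#\sigma(y)$.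
   Formalization: At t = T the representation formula is stated only when the Hopf-Lax minimum is attained, i.e. ℓ(T,x) is nonempty, since (H0),(H1) do not ensure this (H=|p|²/2, σ=-|y|²/(2T), x≠0); the inclusion ℓ ⊂ ℓ* is kept for all t in (0,T]. *)

(* Defs.v *)
From mathcomp Require Import all_boot all_order all_algebra.
From mathcomp Require Import all_classical all_reals all_analysis.
Set Implicit Arguments.
Unset Strict Implicit.
Unset Printing Implicit Defensive.
Import Order.TTheory GRing.Theory Num.Theory.
Import numFieldNormedType.Exports.
Local Open Scope classical_set_scope.
Local Open Scope ring_scope.

(* R^n is 'rV[R]_n. Its library norm is the sup norm, which only serves here   *)
(* to provide the (usual) topology; all norms below are the Euclidean one.     *)

Definition dotp (R : realType) (n : nat) (x y : 'rV[R]_n) : R :=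
  \sum_(i < n) x ord0 i * y ord0 i.

Definition enorm (R : realType) (n : nat) (x : 'rV[R]_n) : R :=
  Num.sqrt (dotp x x).

(* m = min_{y in A} f y; this includes that the minimum is attained. *)
Definition is_min (R : realType) (T : Type) (A : set T) (f : T -> R) (m : R) :=
  (exists2 y, A y & f y = m) /\ (forall y, A y -> m <= f y).

Definition gradient (R : realType) (n : nat) (H : 'rV[R]_n -> R)
    (p : 'rV[R]_n) : 'rV[R]_n :=
  \row_(i < n) 'D_(delta_mx ord0 i) H p.

Definition C1_function (R : realType) (n : nat) (H : 'rV[R]_n -> R) :=
  (forall p, differentiable H p) /\ continuous (gradient H).

Definition strictly_convex (R : realType) (n : nat) (H : 'rV[R]_n -> R) :=
  forall (x y : 'rV[R]_n) (a : R), x != y -> 0 < a -> a < 1 ->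
    H (a *: x + (1 - a) *: y) < a * H x + (1 - a) * H y.

Definition superlinear (R : realType) (n : nat) (H : 'rV[R]_n -> R) :=
  forall M : R, exists N : R, forall p : 'rV[R]_n,
    N < enorm p -> M < H p / enorm p.

Definition H0 (R : realType) (n : nat) (H : 'rV[R]_n -> R) :=
  strictly_convex H /\ superlinear H.

(* Real-valued supremum: for H continuous and superlinear the set is bounded   *)
(* above and the supremum is a maximum.                                        *)
Definition fenchel (R : realType) (n : nat) (H : 'rV[R]_n -> R)
    (z : 'rV[R]_n) : R :=
  sup [set dotp z y - H y | y in [set: 'rV[R]_n]].

Definition hl_cost (R : realType) (n : nat) (H sigma : 'rV[R]_n -> R)
    (t : R) (x y : 'rV[R]_n) : R :=
  sigma y + t * fenchel H (t^-1 *: (x - y)).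

Definition H1 (R : realType) (n : nat) (T : R) (H sigma : 'rV[R]_n -> R) :=
  continuous sigma /\
  forall (t0 : R) (x0 : 'rV[R]_n), 0 <= t0 -> t0 < T ->
    exists r N : R, [/\ 0 < r, 0 < N &
      forall (t : R) (x z : 'rV[R]_n), N < enorm z -> 0 < t -> t < T ->
        `|t - t0| + enorm (x - x0) < r ->
        exists2 m, is_min [set y | enorm y <= N] (hl_cost H sigma t x) m &
          m < hl_cost H sigma t x z].

(* As a real infimum; whenever the minimum exists it is that minimum. *)
Definition hopf_lax (R : realType) (n : nat) (H sigma : 'rV[R]_n -> R)
    (t : R) (x : 'rV[R]_n) : R :=
  inf [set hl_cost H sigma t x y | y in [set: 'rV[R]_n]].

Definition ell (R : realType) (n : nat) (H sigma : 'rV[R]_n -> R)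
    (t : R) (x : 'rV[R]_n) : set 'rV[R]_n :=
  [set y | forall z, hl_cost H sigma t x y <= hl_cost H sigma t x z].

Definition diff_quot (R : realType) (n : nat) (v : 'rV[R]_n -> R)
    (y p h : 'rV[R]_n) : \bar R :=
  ((v (y + h) - v y - dotp p h) / enorm h)%:E.

(* 0^' is the filter of punctured neighborhoods of 0. *)
Definition superdiff (R : realType) (n : nat) (v : 'rV[R]_n -> R)
    (y : 'rV[R]_n) : set 'rV[R]_n :=
  [set p | (limf_esup (diff_quot v y p) (0%R : 'rV[R]_n)^' <= 0)%E].

Definition subdiff (R : realType) (n : nat) (v : 'rV[R]_n -> R)
    (y : 'rV[R]_n) : set 'rV[R]_n :=
  [set p | (0 <= limf_einf (diff_quot v y p) (0%R : 'rV[R]_n)^')%E].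

Definition Dsharp (R : realType) (n : nat) (v : 'rV[R]_n -> R)
    (y : 'rV[R]_n) : set 'rV[R]_n :=
  let D := superdiff v y `|` subdiff v y in
  if D == set0 then [set 0] else D.

Definition gen_characteristic (R : realType) (n : nat)
    (H sigma : 'rV[R]_n -> R) (y : 'rV[R]_n) (c : R -> 'rV[R]_n) :=
  exists2 q, Dsharp sigma y q & forall t, c t = y + t *: gradient H q.

Definition ell_star (R : realType) (n : nat) (H sigma : 'rV[R]_n -> R)
    (t : R) (x : 'rV[R]_n) : set 'rV[R]_n :=
  [set y | exists2 c, gen_characteristic H sigma y c & c t = x].

(* Main.v *)
Require Import Defs.
From mathcomp Require Import all_boot all_order all_algebra.
From mathcomp Require Import all_classical all_reals all_analysis.
From mathcomp Require Import ring lra.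
Import Order.TTheory GRing.Theory Num.Theory.
Import numFieldNormedType.Exports.
Local Open Scope classical_set_scope.
Local Open Scope ring_scope.
Set Implicit Arguments.
Unset Strict Implicit.

(** Let [y] minimize the Hopf-Lax cost [sigma y + t H^*((x - y) / t)] and put
    [z = (x - y) / t].  Superlinearity makes the supremum defining [H^* z]
    attained, at some [q] ([superlinear_supports]), and the first-order condition
    there is [gradient H q = z], that is, [x = y + t *: gradient H q]
    ([gradient_supports]).  So the line issued from [y] with momentum [q] passes
    through [(t, x)], and only [q \in D^# sigma y] remains to be seen.

    Strict convexity of [H] is dual to smoothness of [H^*]: by compactness of
    spheres, [H - <z, .>] grows at least linearly away from its minimizer [q]
    ([supports_linear_growth]), so a small perturbation of the slope [z] moves
    near-maximizers only slightly, and
    [H^*(z + k) <= H^* z + <q, k> + e |k|] for small [k]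
    ([fenchel_superdifferentiable]).  Taking [k = - h / t] in the minimality
    inequality at [y + h] gives [sigma (y + h) >= sigma y + <q, h> - e |h|]:
    [q] is a subgradient of [sigma] at [y] ([ell_subdiff]).

    Hence every minimizer lies in [ell_star] ([ell_sub_ell_star]), and
    restricting the minimum to that set does not change it as soon as a minimizer
    exists.  For [t < T] one exists because the hypothesis on [sigma] confines the
    competition to a ball on which the minimum is attained ([H1_ell_nonempty]). *)

(** * Euclidean structure of the space of row vectors *)

Lemma dotpC (R : realType) (n : nat) (x y : 'rV[R]_n) : dotp x y = dotp y x.
Proof. by apply: eq_bigr => i _; rewrite mulrC. Qed.

Lemma dotpDr (R : realType) (n : nat) (x y z : 'rV[R]_n) :
  dotp x (y + z) = dotp x y + dotp x z.
Proof. by rewrite -big_split; apply: eq_bigr => i _; rewrite mxE mulrDr. Qed.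

Lemma dotpZr (R : realType) (n : nat) (a : R) (x y : 'rV[R]_n) :
  dotp x (a *: y) = a * dotp x y.
Proof. by rewrite mulr_sumr; apply: eq_bigr => i _; rewrite mxE mulrCA. Qed.

Lemma dotpDl (R : realType) (n : nat) (x y z : 'rV[R]_n) :
  dotp (x + y) z = dotp x z + dotp y z.
Proof. by rewrite dotpC dotpDr !(dotpC z). Qed.

Lemma dotpZl (R : realType) (n : nat) (a : R) (x y : 'rV[R]_n) :
  dotp (a *: x) y = a * dotp x y.
Proof. by rewrite dotpC dotpZr dotpC. Qed.

Lemma dotpBr (R : realType) (n : nat) (x y z : 'rV[R]_n) :
  dotp x (y - z) = dotp x y - dotp x z.
Proof. by rewrite dotpDr -scaleN1r dotpZr mulN1r. Qed.

Lemma dotpBl (R : realType) (n : nat) (x y z : 'rV[R]_n) :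
  dotp (x - y) z = dotp x z - dotp y z.
Proof. by rewrite dotpC dotpBr !(dotpC z). Qed.

Lemma dotp_delta (R : realType) (n : nat) (z : 'rV[R]_n) (i : 'I_n) :
  dotp z (delta_mx ord0 i) = z ord0 i.
Proof.
rewrite /dotp (bigD1 i) //= mxE !eqxx mulr1 big1 ?addr0 // => j ji.
by rewrite mxE (negPf ji) andbF mulr0.
Qed.

Lemma dotp_ge0 (R : realType) (n : nat) (x : 'rV[R]_n) : 0 <= dotp x x.
Proof. by apply: sumr_ge0 => i _; rewrite -expr2 sqr_ge0. Qed.

Lemma enorm_ge0 (R : realType) (n : nat) (x : 'rV[R]_n) : 0 <= enorm x.
Proof. exact: sqrtr_ge0. Qed.

Lemma enorm_sqr (R : realType) (n : nat) (x : 'rV[R]_n) :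
  enorm x ^+ 2 = dotp x x.
Proof. by rewrite sqr_sqrtr // dotp_ge0. Qed.

Lemma enormZ (R : realType) (n : nat) (a : R) (x : 'rV[R]_n) :
  enorm (a *: x) = `|a| * enorm x.
Proof.
by rewrite /enorm dotpZl dotpZr mulrA -expr2 sqrtrM ?sqr_ge0 // sqrtr_sqr.
Qed.

(** Links the Euclidean norm to the sup norm that carries the topology, so that
    Euclidean bounds yield compactness. *)
Lemma normr_le_enorm (R : realType) (n : nat) (x : 'rV[R]_n) : `|x| <= enorm x.
Proof.
have coord_le i : `|x ord0 i| <= enorm x.
  rewrite -sqrtr_sqr ler_wsqrtr // /dotp (bigD1 i) //= -expr2 lerDl.
  by apply: sumr_ge0 => j _; rewrite -expr2 sqr_ge0.
rewrite /Num.norm /= mx_normrE; apply: bigmax_le; first exact: enorm_ge0.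
by case=> i j _ /=; rewrite ord1.
Qed.

Lemma enorm0_eq0 (R : realType) (n : nat) (x : 'rV[R]_n) : enorm x = 0 -> x = 0.
Proof.
by move=> x0; apply/eqP; rewrite -normr_le0 (le_trans (normr_le_enorm _)) ?x0.
Qed.

Lemma enorm_zero (R : realType) (n : nat) : enorm (0 : 'rV[R]_n) = 0.
Proof. by rewrite -(scale0r 0) enormZ normr0 mul0r. Qed.

(** Cauchy-Schwarz: expand the nonnegative square of the Euclidean norm of
    [enorm y *: x - enorm x *: y]. *)
Lemma dotp_le_enorm (R : realType) (n : nat) (x y : 'rV[R]_n) :
  dotp x y <= enorm x * enorm y.
Proof.
have := dotp_ge0 (enorm y *: x - enorm x *: y).
rewrite dotpBl !dotpBr !dotpZl !dotpZr (dotpC y x) -!enorm_sqr.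
have := enorm_ge0 x; have := enorm_ge0 y.
have [y0|y0] := eqVneq (enorm y) 0.
  by move=> *; rewrite (enorm0_eq0 y0) -(scale0r 0) dotpZr enormZ normr0 !mul0r mulr0.
have [x0|x0] := eqVneq (enorm x) 0.
  by move=> *; rewrite (enorm0_eq0 x0) -(scale0r 0) dotpZl enormZ normr0 !mul0r.
move=> yge xge H.
have xy0 : 0 < enorm x * enorm y by rewrite mulr_gt0 // lt_def ?x0 ?y0.
by rewrite -(ler_pM2l xy0); nra.
Qed.

Lemma dotp_continuous (R : realType) (n : nat) (z : 'rV[R]_n) :
  continuous (dotp z).
Proof.
move=> x; apply: (@cvg_big _ _ _ _ _ _ _ (nbhs x)) => [|i _].
  exact: add_continuous.
by apply: cvgM; [exact: cvg_cst | exact: coord_continuous].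
Qed.

Lemma enorm_continuous (R : realType) (n : nat) :
  continuous (@enorm R n).
Proof.
move=> x; apply: continuous_comp; last exact: sqrt_continuous.
apply: (@cvg_big _ _ _ _ _ _ _ (nbhs x)) => [|i _].
  exact: add_continuous.
by apply: cvgM; exact: coord_continuous.
Qed.

Lemma enorm_near0 (R : realType) (n : nat) (d : R) : 0 < d ->
  \forall h \near (0 : 'rV[R]_n), enorm h < d.
Proof.
move=> d0; apply: (@cvgr_lt _ _ (nbhs (0 : 'rV[R]_n)) _ _ _ (@enorm_continuous R n 0)).
by rewrite enorm_zero.
Qed.

(** Covers at once the balls and the spheres centred at [q], for
    [C = [set r | r <= N]] and [C = [set N]]. *)
Lemma compact_enorm (R : realType) (n : nat) (q : 'rV[R]_n) (C : set R) (N : R) :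
  closed C -> (forall r, C r -> r <= N) -> compact [set p | C (enorm (p - q))].
Proof.
move=> cC CN; apply: bounded_closed_compact.
  exists (N + `|q|); split; first exact: num_real.
  move=> M NM p /= /CN pN; rewrite -(subrK q p); apply/ltW.
  apply: le_lt_trans NM; apply: le_trans (ler_normD _ _) _.
  by rewrite lerD2r (le_trans (normr_le_enorm _)).
apply: (@preimage_closed _ _ (fun p : 'rV[R]_n => enorm (p - q))) => // p _.
apply: (@continuous_comp _ _ _ (fun p : 'rV[R]_n => p - q) (@enorm R n)).
  by apply: (@cvgB _ _ _ (nbhs p)); [exact: cvg_id | exact: cvg_cst].
exact: enorm_continuous.
Qed.

(** * Conjugacy for strictly convex superlinear functions *)

(** Equivalently, [q] is a maximizer of [dotp z - H]: the affine form reads [z]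
    as a subgradient of [H] at [q], the other one [q] as attaining the supremum in
    [fenchel H z], and both readings are used. *)
Definition supports (R : realType) (n : nat) (H : 'rV[R]_n -> R)
    (z q : 'rV[R]_n) :=
  forall p, H q + dotp z (p - q) <= H p.

(** [H - <z, .>] is coercive: where [H p > (|z| + 1) |p|], Cauchy-Schwarz leaves
    at least [|p|], so a minimizer over a large ball is a global one. *)
Lemma superlinear_supports (R : realType) (n : nat) (H : 'rV[R]_n -> R)
    (z : 'rV[R]_n) : continuous H -> superlinear H -> exists q, supports H z q.
Proof.
move=> cH sH; have [N HN] := sH (enorm z + 1).
pose phi p := H p - dotp z p.
(* Beyond [N] superlinearity is in force, beyond [|phi 0|] it beats [phi 0]. *)
pose M := Num.max N `|phi 0|.
have M0 : 0 <= M by rewrite le_max normr_ge0 orbT.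
have coercive p : M < enorm p -> phi 0 <= phi p.
  rewrite gt_max => /andP[Np phip].
  have p0 : 0 < enorm p by apply: le_lt_trans phip.
  have := HN p Np; rewrite ltr_pdivlMr // => Hp.
  have := dotp_le_enorm z p; have := ler_norm (phi 0).
  have -> : phi p = H p - dotp z p by [].
  lra.
have cphi : continuous phi.
  by move=> p; apply: (@cvgB _ _ _ (nbhs p)); [exact: cH | exact: dotp_continuous].
have := @compact_enorm R n 0 [set r | r <= M] M (@closed_le _ M) (fun r rM => rM).
set B := (X in compact X) => cB.
have B0 : B 0 by rewrite /B /= subr0 enorm_zero.
have [|q /set_mem qB qmin] := EVT_min_rV _ cB (continuous_subspaceT cphi).
  by exists 0.
suff qle p : phi q <= phi p.
  by exists q => p; have := qle p; rewrite /phi dotpBr; lra.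
have [pM|pM] := leP (enorm p) M.
  by apply: qmin; apply/mem_set; rewrite /B /= subr0.
by apply: le_trans (coercive _ pM); apply/qmin/mem_set.
Qed.

Lemma fenchel_supports (R : realType) (n : nat) (H : 'rV[R]_n -> R)
    (z q : 'rV[R]_n) : supports H z q -> fenchel H z = dotp z q - H q.
Proof.
move=> Hq; apply/eqP; rewrite eq_le; apply/andP; split.
  apply: ge_sup; first by exists (dotp z q - H q); exists q.
  by move=> _ [p _ <-]; have := Hq p; rewrite dotpBr; lra.
apply: ub_le_sup; last by exists q.
exists (dotp z q - H q) => _ [p _ <-]; have := Hq p; rewrite dotpBr; lra.
Qed.

(** Along each coordinate direction [H - <z, .>] has a minimum at [q], so its
    derivative vanishes there. *)
Lemma gradient_supports (R : realType) (n : nat) (H : 'rV[R]_n -> R)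
    (z q : 'rV[R]_n) :
  (forall p, differentiable H p) -> supports H z q -> gradient H q = z.
Proof.
move=> dH Hq; apply/rowP => i; rewrite mxE -(dotp_delta z).
set v := delta_mx ord0 i.
pose f (s : R) := H (s *: v + q) - s * dotp z v.
have dline (s : R) : derivable (fun s : R => H (s *: v + q)) s 1.
  apply/derivable1_diffP; apply: (@differentiable_comp _ _ _ _ _ H) => //.
have dlin (s : R) : derivable (fun s : R => s * dotp z v) s 1.
  by apply: derivableM.
have df (s : R) : derivable f s 1 by exact: derivableB.
have fmin (s : R) : f 0 <= f s.
  by have := Hq (s *: v + q); rewrite addrK dotpZr /f scale0r add0r mul0r; lra.
have f'0 : is_derive (0 : R) (1 : R) f 0.
  apply: (@derive1_at_min _ f (-1) 1) => //.
  by rewrite in_itv /= ltrN10 ltr01.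
have -> : 'D_v H q = 'D_1 (fun s : R => H (s *: v + q)) 0.
  rewrite /derive; set g1 := fun h => h^-1 *: _; set g2 := fun h => h^-1 *: _.
  suff -> : g1 = g2 by []; apply/funext => s; rewrite /g1 /g2 /=.
  by rewrite addr0 scale0r add0r [_%:A]mulr1.
have := @derive_val _ _ _ _ _ _ _ f'0.
rewrite (deriveB (dline 0) (dlin 0)) => /eqP; rewrite subr_eq0 => /eqP ->.
rewrite (@deriveM _ _ id (cst (dotp z v))) // derive_id derive_cst scaler0 add0r.
by rewrite [_%:A]mulr1.
Qed.

(** Were the affine minorant to touch [H] at [p] as well, strict convexity would
    push [H] below it at the midpoint of [p] and [q]. *)
Lemma supports_lt (R : realType) (n : nat) (H : 'rV[R]_n -> R)
    (z q p : 'rV[R]_n) :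
  strictly_convex H -> supports H z q -> p != q -> H q + dotp z (p - q) < H p.
Proof.
move=> Hsc Hq pq.
have := Hsc p q 2^-1 pq; rewrite invr_gt0 ltr0n invf_lt1 ?ltr1n ?ltr0n //.
move=> /(_ isT isT); have := Hq (2^-1 *: p + (1 - 2^-1) *: q).
have -> : 2^-1 *: p + (1 - 2^-1) *: q - q = 2^-1 *: (p - q).
  by rewrite scalerBl scale1r scalerBr addrA addrAC addrK.
rewrite dotpZr; set X := dotp z _; lra.
Qed.

(** The gap [phi] between [H] and its affine minorant has a positive minimum on the
    sphere of radius [e] around [q]; since [phi] is convex and vanishes at [q], it
    grows at least proportionally along rays from [q] beyond that sphere. *)
Lemma supports_linear_growth (R : realType) (n : nat) (H : 'rV[R]_n -> R)
    (z q : 'rV[R]_n) (e : R) :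
  continuous H -> strictly_convex H -> supports H z q -> 0 < e ->
  exists2 d, 0 < d & forall p, e <= enorm (p - q) ->
    H q + dotp z (p - q) + d * enorm (p - q) <= H p.
Proof.
move=> cH Hsc Hq e0.
pose phi p := H p - H q - dotp z (p - q).
have cphi : continuous phi.
  move=> p; apply: (@cvgB _ _ _ (nbhs p)).
    by apply: (@cvgB _ _ _ (nbhs p)); [exact: cH | exact: cvg_cst].
  apply: (@continuous_comp _ _ _ (fun p : 'rV[R]_n => p - q) (dotp z)).
    by apply: (@cvgB _ _ _ (nbhs p)); [exact: cvg_id | exact: cvg_cst].
  exact: dotp_continuous.
pose S := [set p : 'rV[R]_n | enorm (p - q) = e].
have cS : compact S.
  by apply: (@compact_enorm R n q [set e] e (@closed_eq _ e)) => r ->.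
(* Radial projection towards [q] onto the sphere of radius [e]. *)
pose proj p := q + (e / enorm (p - q)) *: (p - q).
have projS p : e <= enorm (p - q) -> S (proj p).
  move=> ep; have p0 := lt_le_trans e0 ep.
  rewrite /S /= /proj addrC addKr enormZ ger0_norm ?divr_ge0 ?enorm_ge0 ?ltW //.
  by rewrite divfK // gt_eqF.
(* The sphere is empty in dimension 0; then no [p] is that far from [q]. *)
have [S0|S0] := pselect (S !=set0); last first.
  by exists 1 => // p /projS Sp; case: S0; exists (proj p).
have [m /set_mem mS mmin] := EVT_min_rV S0 cS (continuous_subspaceT cphi).
have phim0 : 0 < phi m.
  have mq : m != q.
    apply: contraTneq e0 => mq; move: mS; rewrite /S /= mq subrr enorm_zero => <-.
    by rewrite ltxx.
  by have := supports_lt Hsc Hq mq; rewrite /phi; lra.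
exists (phi m / e) => [|p ep]; first exact: divr_gt0.
have p0 := lt_le_trans e0 ep.
set a := e / enorm (p - q).
have a0 : 0 < a by exact: divr_gt0.
suff : phi (proj p) <= a * phi p.
  have := mmin (proj p) (mem_set (projS p ep)) => /le_trans/[apply].
  rewrite /a mulrAC ler_pdivlMr // => mp.
  have : phi m / e * enorm (p - q) <= phi p.
    by rewrite mulrAC ler_pdivrMr // [leRHS]mulrC.
  by rewrite /phi; lra.
have : a <= 1 by rewrite ler_pdivrMr // mul1r.
rewrite le_eqVlt => /predU1P[a1|a_lt1].
  by rewrite /proj -/a a1 scale1r addrC subrK mul1r.
have pq : p != q by apply: contraTneq p0 => ->; rewrite subrr enorm_zero ltxx.
have := Hsc p q a pq a0 a_lt1.
have -> : a *: p + (1 - a) *: q = proj p.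
  by rewrite scalerBl scale1r /proj -/a scalerBr addrCA.
have phi_proj : phi (proj p) = H (proj p) - H q - a * dotp z (p - q).
  by rewrite /phi; congr (_ - _); rewrite /proj -/a addrC addKr dotpZr.
by rewrite phi_proj /phi; lra.
Qed.

(** In the supremum defining [fenchel H (z + k)], the points [p] with
    [|p - q| < e] contribute at most [e |k|] beyond the affine term; farther
    points are beaten by the linear growth of [H - <z, .>] as soon as [|k|] is below
    its rate [d].  With subdifferentiability, which is automatic for a conjugate,
    this says that [q] is the gradient of [H^*] at [z]; this half is the one that
    minimality can exploit. *)
Lemma fenchel_superdifferentiable (R : realType) (n : nat) (H : 'rV[R]_n -> R)
    (z q : 'rV[R]_n) (e : R) :
  continuous H -> strictly_convex H -> supports H z q -> 0 < e ->
  exists2 d, 0 < d & forall k, enorm k <= d ->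
    fenchel H (z + k) <= fenchel H z + dotp q k + e * enorm k.
Proof.
move=> cH Hsc Hq e0.
have [d d0 growth] := supports_linear_growth cH Hsc Hq e0.
exists d => // k kd; rewrite (fenchel_supports Hq) (dotpC q).
apply: ge_sup; first by exists (dotp (z + k) q - H q); exists q.
move=> _ [p _ <-]; rewrite dotpDl.
have := dotp_le_enorm k (p - q); have k0 := enorm_ge0 k.
have p0 := enorm_ge0 (p - q).
have [ep|pe] := leP e (enorm (p - q)).
  have := growth p ep; rewrite !dotpBr => Hp kpq.
  have : enorm k * enorm (p - q) <= d * enorm (p - q) by exact: ler_wpM2r.
  have : 0 <= e * enorm k by rewrite mulr_ge0 // ltW.
  lra.
have : enorm k * enorm (p - q) <= enorm k * e by rewrite ler_wpM2l // ltW.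
have := Hq p; rewrite !dotpBr; lra.
Qed.

(** * Minimizers start generalized characteristics *)

Lemma near_subdiff (R : realType) (n : nat) (v : 'rV[R]_n -> R)
    (y q : 'rV[R]_n) :
  (forall e, 0 < e -> \forall h \near (0 : 'rV[R]_n),
     - (e * enorm h) <= v (y + h) - v y - dotp q h) ->
  subdiff v y q.
Proof.
move=> vq; rewrite /subdiff /= limf_einfE.
apply/lee_subgt0Pr => e e0; rewrite sub0e -EFinN.
pose V := [set h : 'rV[R]_n | - (e * enorm h) <= v (y + h) - v y - dotp q h].
apply: (@le_trans _ _ (ereal_inf (diff_quot v y q @` V))); last first.
  apply: ereal_sup_ubound; exists V => //.
  by apply: filterS (vq e e0) => h Vh _.
apply: le_ereal_inf_tmp => _ [h Vh <-]; rewrite /diff_quot lee_fin.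
(* At [h = 0] the quotient is 0 by the convention on division by 0. *)
have [h0|h0] := eqVneq (enorm h) 0; first by rewrite h0 invr0 mulr0; lra.
by rewrite ler_pdivlMr ?mulNr // lt_def h0 enorm_ge0.
Qed.

(** Minimality bounds the increments of [sigma] from below by those of
    [- t H^*((x - .) / t)], which the first-order upper bound on [H^*] controls. *)
Lemma ell_subdiff (R : realType) (n : nat) (H sigma : 'rV[R]_n -> R)
    (t : R) (x y q : 'rV[R]_n) :
  continuous H -> strictly_convex H -> 0 < t -> ell H sigma t x y ->
  supports H (t^-1 *: (x - y)) q -> subdiff sigma y q.
Proof.
move=> cH Hsc t0 ymin Hq; apply: near_subdiff => e e0.
have [d d0 Hd] := fenchel_superdifferentiable cH Hsc Hq e0.
have near_h : \forall h \near (0 : 'rV[R]_n), enorm h < t * d.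
  by apply: enorm_near0; exact: mulr_gt0.
apply: filterS near_h => h hd.
have := ymin (y + h); rewrite /hl_cost.
have -> : t^-1 *: (x - (y + h)) = t^-1 *: (x - y) + (- t^-1) *: h.
  by rewrite opprD addrA scalerDr scalerN scaleNr.
have ti : `|- t^-1| = t^-1 by rewrite normrN gtr0_norm ?invr_gt0.
have := Hd (- t^-1 *: h); rewrite enormZ ti dotpZr mulrC ler_pdivrMr //.
rewrite [d * t]mulrC => /(_ (ltW hd)).
rewrite -(ler_pM2l t0) !mulrDr.
have -> : t * (- t^-1 * dotp q h) = - dotp q h.
  by rewrite mulNr mulrN mulVKf ?gt_eqF.
have -> : t * (e * (enorm h / t)) = e * enorm h.
  by rewrite mulrC mulrA divfK ?gt_eqF.
lra.
Qed.

Lemma ell_sub_ell_star (R : realType) (n : nat) (H sigma : 'rV[R]_n -> R)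
    (t : R) (x : 'rV[R]_n) :
  (forall p, differentiable H p) -> H0 H -> 0 < t ->
  ell H sigma t x `<=` ell_star H sigma t x.
Proof.
move=> dH [Hsc Hsl] t0 y ymin.
have cH : continuous H by move=> p; apply: differentiable_continuous.
have [q Hq] := superlinear_supports (t^-1 *: (x - y)) cH Hsl.
exists (fun s => y + s *: gradient H q).
  exists q => //; have qD := ell_subdiff cH Hsc t0 ymin Hq.
  rewrite /Dsharp; case: eqP => [D0|_]; last by right.
  suff : (superdiff sigma y `|` subdiff sigma y) q by rewrite D0.
  by right.
by rewrite (gradient_supports dH Hq) scalerA divff ?gt_eqF // scale1r addrC subrK.
Qed.

(** * The Hopf-Lax minimum *)

(** The hypothesis only produces the minimum over the ball together with a
    competitor outside it, so some point far away is needed to trigger it; in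
    dimension 0 there is none, but the space is then a single point. *)
Lemma H1_ell_nonempty (R : realType) (n : nat) (T : R)
    (H sigma : 'rV[R]_n -> R) (t : R) (x : 'rV[R]_n) :
  H1 T H sigma -> 0 < t -> t < T -> ell H sigma t x !=set0.
Proof.
case: n H sigma x => [|n] H sigma x [_ h1] t0 tT.
  by exists 0 => z; rewrite (thinmx0 z).
have [r [N [r0 N0 hN]]] := h1 t x (ltW t0) tT.
have far z : N < enorm z ->
    exists2 m, is_min [set y | enorm y <= N] (hl_cost H sigma t x) m &
      m < hl_cost H sigma t x z.
  by move=> zN; apply: hN; rewrite // !subrr normr0 enorm_zero addr0.
pose z0 : 'rV[R]_n.+1 := (N + 1) *: delta_mx ord0 ord0.
have z0N : N < enorm z0.
  rewrite /z0 enormZ /enorm dotp_delta mxE !eqxx sqrtr1 mulr1.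
  by rewrite gtr0_norm; lra.
have [m [[y yN ym] mmin] _] := far z0 z0N.
exists y => z; rewrite ym; have [zN|/far[m' [[y' y'N <-] _] /ltW]] := leP (enorm z) N.
  exact: mmin.
by apply: le_trans; exact: mmin.
Qed.

Lemma hopf_lax_ell (R : realType) (n : nat) (H sigma : 'rV[R]_n -> R)
    (t : R) (x y : 'rV[R]_n) :
  ell H sigma t x y -> hopf_lax H sigma t x = hl_cost H sigma t x y.
Proof.
move=> ymin; have ylb : lbound [set hl_cost H sigma t x z | z in [set: 'rV[R]_n]]
  (hl_cost H sigma t x y) by move=> _ [z _ <-]; exact: ymin.
apply/eqP; rewrite eq_le; apply/andP; split.
  by apply: ge_inf; [exists (hl_cost H sigma t x y) | exists y].
by apply: lb_le_inf => //; exists (hl_cost H sigma t x y); exists y.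
Qed.

Unset Implicit Arguments.

Theorem theorem3p1 (R : realType) (n : nat) (T : R) (H sigma : 'rV[R]_n -> R)
    (T_gt0 : 0 < T) (HC1 : C1_function H) (sigmaC : continuous sigma)
    (hH0 : H0 H) (hH1 : H1 T H sigma)
    (t : R) (x : 'rV[R]_n) (t_gt0 : 0 < t) (t_leT : t <= T) :
  ell H sigma t x `<=` ell_star H sigma t x /\
  (* at the endpoint t = T, which (H1) does not control, the Hopf-Lax
     minimum is required to exist *)
  ((t = T -> ell H sigma t x !=set0) ->
    is_min [set: 'rV[R]_n] (hl_cost H sigma t x) (hopf_lax H sigma t x) /\
    is_min (ell_star H sigma t x) (hl_cost H sigma t x)
      (hopf_lax H sigma t x)).
Proof.
have sub := @ell_sub_ell_star R n H sigma t x HC1.1 hH0 t_gt0.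
split=> // ell_T.
have [y ymin] : ell H sigma t x !=set0.
  have [/ell_T //|tT] := eqVneq t T.
  by apply: (H1_ell_nonempty x hH1 t_gt0); rewrite lt_neqAle tT t_leT.
rewrite (hopf_lax_ell ymin).
by split; split=> //; exists y => //; exact: sub.
Qed.
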